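(* Every one-dimensional subshift of finite type (i.e. every $\mathbb{Z}$-subshift of finite type) belongs to $\mathcal{L}^0$.
   Context: **Subshifts.** For $d\ge 1$ and a finite alphabet $A$, $A^{\mathbb{Z}^d}$ carries the product topology and the shift action $(\sigma^p x)(q)=x(p+q)$. A $\mathbb{Z}^d$-subshift is a closed set $X\subseteq A^{\mathbb{Z}^d}$ with $\sigma^p(X)=X$ for all $p\in\mathbb{Z}^d$. It is of finite type (SFT) if there is a finite set $P$ of finite patterns (elements of $A^F$, $F\subseteq\mathbb{Z}^d$ finite) such that $X$ is the set of configurations in which no $\pi\in P$ appears at any position. A subshift $Y$ is a factor of a subshift $X$ if there is a continuous surjective $f:X\to Y$ with $\sigma^p\circ f=f\circ\sigma^p$ for all $p$. A finite product of $\mathbb{Z}^d$-subshifts is viewed as a $\mathbb{Z}^d$-subshift over the product alphabet. **The class $\mathcal{L}^0$.** The basic $\mathbb{Z}^d$-subshifts are: the fullshifts $A^{\mathbb{Z}^d}$; the periodic shifts $A^{\mathbb{Z}^d/H}:=\{x\in A^{\mathbb{Z}^d}: x(p+h)=x(p)\ \forall p\in\mathbb{Z}^d,h\in H\}$ for $H$ a subgroup of $\mathbb{Z}^d$; the countable (possibly finite) subshifts. $\mathcal{L}^0_d$ is the smallest class of $\mathbb{Z}^d$-subshifts containing the basic subshifts and closed under finite products and factors; $\mathcal{L}^0=\bigsqcup_{d\ge1}\mathcal{L}^0_d$. *)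

(* Defs.v *)
From HB Require Import structures.
From mathcomp Require Import all_boot all_order all_algebra finmap.
From mathcomp Require Import all_classical all_reals all_analysis.

Set Implicit Arguments.
Unset Strict Implicit.
Unset Printing Implicit Defensive.

Import GRing.Theory.

Local Open Scope classical_set_scope.
Local Open Scope ring_scope.

(* The alphabet is discrete and A^(Z^d) carries the product topology. *)
Definition config (d : nat) (A : finType) : topologicalType :=
  {ptws 'rV[int]_d -> discrete_topology A}.

Definition sigma_shift (d : nat) (A : finType) (p : 'rV[int]_d)
    (x : config d A) :
  config d A := fun q => x (p + q).

Definition is_subshift (d : nat) (A : finType) (X : set (config d A)) : Prop :=
  closed X /\ forall p : 'rV[int]_d, sigma_shift p @` X = X.

(* A finite partial map w is an element of A^F with F = domf w finite. *)
Definition pattern (d : nat) (A : finType) := {fmap 'rV[int]_d -> A}.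

Definition appears_at (d : nat) (A : finType) (w : pattern d A)
    (x : config d A) (p : 'rV[int]_d) : Prop :=
  forall q : domf w, x (p + val q) = w q.

Definition finite_type (d : nat) (A : finType) (X : set (config d A)) : Prop :=
  exists P : {fset pattern d A},
    X = [set x | forall w, w \in P -> forall p, ~ appears_at w x p].

(* X and Y are coerced to types carrying the subspace topology.  Whenever X is
   shift-invariant, the last clause says that f commutes with every shift. *)
Definition is_factor (d : nat) (A B : finType)
    (X : set (config d A)) (Y : set (config d B)) : Prop :=
  exists f : X -> Y,
    [/\ continuous f,
        range f = setT
      & forall (p : 'rV[int]_d) (x x' : X),
          \val x' = sigma_shift p (\val x) ->
          \val (f x') = sigma_shift p (\val (f x))].

Definition full_shift (d : nat) (A : finType) : set (config d A) := setT.

Definition periodic_shift (d : nat) (A : finType) (H : {pred 'rV[int]_d}) :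
  set (config d A) := [set x | forall p h, h \in H -> x (p + h) = x p].

Definition product_shift (d : nat) (I : finType) (A : I -> finType)
    (X : forall i, set (config d (A i))) :
    set (config d {dffun forall i, A i}) :=
  [set x : config d {dffun forall i, A i} |
    forall i, X i (fun p => (x p : {dffun forall i, A i}) i)].

Inductive basic_subshift (d : nat) (A : finType) :
    set (config d A) -> Prop :=
| basic_full : basic_subshift (@full_shift d A)
| basic_periodic (H : {pred 'rV[int]_d}) :
    zmod_closed H -> basic_subshift (@periodic_shift d A H)
| basic_countable (X : set (config d A)) :
    is_subshift X -> countable X -> basic_subshift X.

Inductive L0_dim (d : nat) : forall A : finType, set (config d A) -> Prop :=
| L0_basic (A : finType) (X : set (config d A)) :
    basic_subshift X -> L0_dim X
| L0_product (I : finType) (A : I -> finType)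
    (X : forall i, set (config d (A i))) :
    (forall i, L0_dim (X i)) -> L0_dim (product_shift X)
| L0_factor (A B : finType) (X : set (config d A)) (Y : set (config d B)) :
    L0_dim X -> is_subshift Y -> is_factor X Y -> L0_dim Y.

(* The disjoint union over the dimensions d >= 1 *)
Definition L0 (d : nat) (A : finType) (X : set (config d A)) : Prop :=
  (1 <= d)%N /\ L0_dim X.

(* Main.v *)
Require Import Defs.
From mathcomp Require Import all_boot all_order all_algebra.
From mathcomp Require Import finmap.
From mathcomp Require Import all_classical all_reals all_analysis.
From mathcomp Require Import zify.

(** Present the subshift as the set of labels of the bi-infinite paths of a
finite graph (V, e).  Some power e^N, with N > 0, of the adjacency relation is
transitive, because powers of a Boolean matrix are eventually periodic.
Sampling a path at the multiples of N gives a sequence v_j with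
v_j e^N v_{j+1}, so its classes for "equal, or related both ways by e^N" are
monotone, hence constant near -oo and near +oo: the sequences of classes,
stretched by N and carrying a phase modulo N, form a countable subshift.
Given such a sequence, a full shift freely chooses v_j in its class and a path
of length N from v_j to v_{j+1}; this is a sliding block code onto the
subshift. *)

Set Implicit Arguments.
Unset Strict Implicit.
Unset Printing Implicit Defensive.

Import GRing.Theory Num.Theory.

Local Open Scope classical_set_scope.
Local Open Scope ring_scope.

(** * Topology of configuration spaces *)

Lemma nbhs_cylinder (d : nat) (A : finType) (x : config d A)
    (s : seq 'rV[int]_d) :
  nbhs x [set y : config d A | forall q, q \in s -> y q = x q].
Proof.
elim: s => [|q s IHs]; first by apply: filterS filterT => y _ q.
have nq : nbhs x [set y : config d A | y q = x q].
  exact: (@proj_continuous _ (fun=> discrete_topology A) q x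
    [set a | a = x q]).
apply: filterS (filterI nq IHs) => y [yq ys] r.
by rewrite inE => /predU1P [-> //|]; apply: ys.
Qed.

(** Cylinders are neighbourhoods, so a point of the closure of [C] agrees with points of [C] on
    every finite window. *)
Lemma closed_local (d : nat) (A : finType) (C : set (config d A)) :
  (forall x, (forall s : seq 'rV[int]_d,
     exists2 y : config d A, C y & forall q, q \in s -> y q = x q) -> C x) ->
  closed C.
Proof.
move=> loc x clx; apply: loc => s.
by have [y [Cy ys]] := clx _ (nbhs_cylinder x s); exists y.
Qed.

(** Continuity is tested one coordinate [p] of the image at a time, and this coordinate is constant
    on the cylinder over the window [p + s]. *)
Lemma sliding_block_continuous (d : nat) (A B : finType)
    (X : set (config d A)) (Y : set (config d B)) (f : X -> Y)
    (s : seq 'rV[int]_d) :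
  (forall (x x' : X) p,
     (forall q, q \in s ->
        (\val x : config d A) (p + q) = (\val x' : config d A) (p + q)) ->
     (\val (f x) : config d B) p = (\val (f x') : config d B) p) ->
  continuous f.
Proof.
move=> loc; apply: continuous_comp_initial => x.
apply/cvg_sup => [|p]; first exact/fmap_filter/(nbhs_filter x).
move: x; apply: (@continuous_comp_initial _ X (discrete_topology B)
  (fun g : config d B => g p)) => x.
move=> U /= Ux.
have nx : nbhs x [set y : X | forall q, q \in [seq p + q | q <- s] ->
    (\val y : config d A) q = (\val x : config d A) q].
  exact: (@initial_continuous X _ set_val x _ (nbhs_cylinder (\val x) _)).
rewrite /= nbhs_simpl /=.
apply: filterS nx => y /= yx.
have eqp : (\val (f x) : config d B) p = (\val (f y) : config d B) p.
  by apply: loc => q qs; rewrite -[LHS]yx // map_f.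
have /nbhs_singleton : nbhs ((\val (f x) : config d B) p) U := Ux.
by rewrite eqp.
Qed.

(** * Powers of a finite relation *)

Definition bipath (V : Type) (e : rel V) (z : int -> V) : Prop :=
  forall i, e (z i) (z (i + 1)).

Lemma finite_collision (T : finType) (g : nat -> T) :
  exists a b, (a < b)%N /\ g a = g b.
Proof.
have /injectivePn[a [b neq_ab gab]] : ~~ injectiveb (fun i : 'I_#|T|.+1 => g i).
  apply/injectiveP => /leq_card; rewrite card_ord ltnn //.
have [ab|ba|/val_inj ab] := ltngtP a b; last by rewrite ab eqxx in neq_ab.
  by exists a, b.
by exists b, a.
Qed.

Section Steps.
Context (V : finType) (e : rel V).

Definition walk (u v : V) (p : seq V) : bool := path e u p && (last u p == v).

Definition steps (n : nat) (u v : V) : bool :=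
  [exists p : n.-tuple V, walk u v p].

Lemma stepsP (n : nat) (u v : V) :
  reflect (exists2 p, size p = n & walk u v p) (steps n u v).
Proof.
apply: (iffP existsP) => [[p uv]|[p /eqP sp uv]]; last by exists (Tuple sp).
by exists p; rewrite ?size_tuple.
Qed.

Lemma steps_add (m n : nat) (u w : V) :
  steps (m + n) u w <-> exists2 v, steps m u v & steps n v w.
Proof.
split=> [/stepsP[p sp]|[v /stepsP[p <- /andP[up /eqP lp]]]].
  rewrite /walk -[p](cat_take_drop m) cat_path last_cat.
  move=> /andP[/andP[pt pd] l].
  exists (last u (take m p)); apply/stepsP.
    by exists (take m p); rewrite ?size_takel ?sp ?leq_addr // /walk pt /=.
  by exists (drop m p); rewrite ?size_drop ?sp ?addKn // /walk pd.
move=> /stepsP[q <- /andP[vq lq]]; apply/stepsP; exists (p ++ q).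
  by rewrite size_cat.
by rewrite /walk cat_path last_cat up lp vq.
Qed.

Lemma steps_eq_add (a b c : nat) :
  steps a =2 steps b -> steps (a + c) =2 steps (b + c).
Proof.
move=> eab u w; apply/idP/idP => /steps_add[v]; rewrite (eab, =^~ eab) => uv vw;
  by apply/steps_add; exists v; rewrite // -eab.
Qed.

Lemma steps_transitive : exists n, transitive (steps n.+1).
Proof.
have [a [b [ltab /ffunP eab]]] :=
  finite_collision (fun n => [ffun x : V * V => steps n x.1 x.2]).
have {}eab : steps a =2 steps (a + (b - a)).
  by move=> u v; have := eab (u, v); rewrite !ffunE subnKC // ltnW.
set p := (b - a)%N in eab; have p_gt0 : (0 < p)%N by rewrite subn_gt0.
have per n k : (a <= n)%N -> steps (n + k * p) =2 steps n.
  move=> le_an; elim: k => [|k IHk] u v; first by rewrite addn0.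
  have -> : (n + k.+1 * p = a + p + (n - a + k * p))%N by lia.
  have nE : (a + (n - a + k * p) = n + k * p)%N by lia.
  by rewrite -(steps_eq_add _ eab) nE IHk.
(* The exponent is a multiple of the period [p], at least [a], and positive even when [a = 0]; by
   [per], twice this length reduces to this length. *)
have N_gt0 : (0 < a.+1 * p)%N by rewrite muln_gt0.
exists (a.+1 * p).-1; rewrite prednK // => v u w uv vw.
rewrite -(per _ a.+1); first by apply/steps_add; exists v.
by rewrite (leq_trans (leqnSn a)) // leq_pmulr.
Qed.

End Steps.

(** * Classes of mutually related vertices, and their rank *)

Section Classes.
Context (V : finType) (R : rel V) (Rtr : transitive R).

(** [R] need not be reflexive: a vertex not related to itself forms a class of its own. *)
Definition sim (u v : V) : bool := (u == v) || (R u v && R v u).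

(** A class is encoded by a canonical member, which avoids a quotient type. *)
Definition rep (v : V) : V := choose (sim v) v.

Lemma sim_refl : reflexive sim. Proof. by move=> v; rewrite /sim eqxx. Qed.

Lemma sim_sym : symmetric sim.
Proof. by move=> u v; rewrite /sim eq_sym andbC. Qed.

Lemma sim_trans : transitive sim.
Proof.
move=> v u w /predU1P[-> //|/andP[uv vu]] /predU1P[<-|/andP[vw wv]].
  by rewrite /sim uv vu orbT.
by rewrite /sim (Rtr uv vw) (Rtr wv vu) orbT.
Qed.

Lemma sim_rep (v : V) : sim v (rep v).
Proof. exact: chooseP (sim_refl v). Qed.

Lemma rep_sim (u v : V) : sim u v -> rep u = rep v.
Proof.
move=> uv; have eq_uv : sim u =1 sim v.
  move=> w; apply/idP/idP; apply: sim_trans => //; by rewrite sim_sym.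
rewrite /rep (eq_choose eq_uv); apply: choose_id; last exact: sim_refl.
by rewrite sim_sym.
Qed.

Lemma rep_rep (v : V) : rep (rep v) = rep v.
Proof. by apply/esym/rep_sim/sim_rep. Qed.

Lemma sim_compat (u u' v v' : V) : sim u u' -> sim v v' -> R u v -> R u' v'.
Proof.
move=> su sv uv; have {su} : R u' v.
  by case/predU1P: su => [<- //|/andP[_ u'u]]; apply: Rtr uv.
by case/predU1P: sv => [<- //|/andP[vv' _]] u'v; apply: Rtr vv'.
Qed.

Definition rank (v : V) : nat := #|[pred u | (u == v) || R v u]|.

(** By transitivity [u] reaches all that [v] reaches. But [v] does not reach [u], otherwise both
    would lie in one class and have the same representative. *)
Lemma rank_lt (u v : V) :
  rep u = u -> rep v = v -> R u v -> u != v -> (rank v < rank u)%N.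
Proof.
move=> ru rv uv neq_uv; apply/proper_card/properP; split.
  apply/fintype.subsetP=> w; rewrite !inE => /predU1P[->|vw].
    by rewrite uv orbT.
  by rewrite (Rtr uv vw) orbT.
exists u; rewrite !inE ?eqxx // negb_or neq_uv /=.
apply/negP => vu; case/eqP: neq_uv.
by rewrite -ru -rv; apply: rep_sim; rewrite /sim uv vu orbT.
Qed.

End Classes.

(** Every change of value costs rank: by induction on a bound for the initial rank, the sequence is
    restarted just after a change. *)
Lemma eventually_constant (T : eqType) (r : T -> nat) (t : nat -> T) :
  (forall m, t m != t m.+1 -> (r (t m.+1) < r (t m))%N) ->
  exists n, forall m, (n <= m)%N -> t m = t n.
Proof.
have [k] := ubnP (r (t 0%N)); elim: k t => // k IHk t rk dec.
have [t_cst|] := pselect (forall m, t m = t m.+1).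
  by exists 0%N => m _; elim: m => // m <-.
move=> /existsNP[m /eqP tm].
have rm : (r (t m) <= r (t 0%N))%N.
  elim: (m) => // j; apply: leq_trans.
  by have [->|/dec/ltnW] := eqVneq (t j) (t j.+1).
have [||n n_cst] := IHk (fun j => t (m.+1 + j)%N).
- by rewrite addn0; apply: leq_trans (dec _ tm) _; apply: leq_trans rm _.
- by move=> j; rewrite addnS; apply: dec.
exists (m.+1 + n)%N => j le_j; rewrite -(subnKC le_j) -addnA n_cst //.
exact: leq_addr.
Qed.

(** * Sequences of classes stretched over blocks *)

Section Blocks.
Context (V : finType) (R : rel V) (n : nat).

(* In a letter (t, k), t represents the class attached to the current block of
   length n.+1 and k is the position inside that block. *)
Definition block_edge : rel (V * 'I_n.+1) := fun c c' =>
  [&& rep R c.1 == c.1, c'.2 == ordS c.2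
    & if c'.2 == 0 :> nat then R c.1 c'.1 else c'.1 == c.1].

Context (y : int -> V * 'I_n.+1) (yE : bipath block_edge y).

Lemma block_step (i : int) :
  [/\ rep R (y i).1 = (y i).1, (y (i + 1)).2 = ((y i).2.+1 %% n.+1)%N :> nat
    & if (y (i + 1)).2 == 0 :> nat then is_true (R (y i).1 (y (i + 1)).1)
      else (y (i + 1)).1 = (y i).1].
Proof.
have /and3P[/eqP rept /eqP phase next] := yE i; split => //.
  by rewrite phase.
by case: ifP next => // _ /eqP.
Qed.

Lemma block_start (i : int) :
  (y (i - (y i).2%:Z)).2 = 0 :> nat /\ (y (i - (y i).2%:Z)).1 = (y i).1.
Proof.
suff start m j : (y j).2 = m :> nat ->
    (y (j - m%:Z)).2 = 0 :> nat /\ (y (j - m%:Z)).1 = (y j).1 by exact: start.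
elim: m j => {i} [|m IHm] i; first by rewrite subr0.
have [_] := block_step (i - 1); rewrite subrK => -> + ym.
(* A predecessor at position [n] would put [i] at position [0], not [m.+1]; hence one step back
   stays in the block. *)
move: (ltn_ord (y (i - 1)).2); rewrite leq_eqVlt => /predU1P[en|lt_m].
  by rewrite en modnn in ym.
rewrite modn_small // in ym *; rewrite ym /= => ->.
have -> : i - m.+1%:Z = i - 1 - m%:Z by lia.
by apply: IHm; case: ym.
Qed.

Context (s : int) (s0 : (y s).2 = 0 :> nat).

Lemma block_interior (m : nat) :
  (m <= n)%N -> (y (s + m%:Z)).2 = m :> nat /\ (y (s + m%:Z)).1 = (y s).1.
Proof.
elim: m => [|m IHm] le_mn; first by rewrite addr0.
have [ym tm] := IHm (ltnW le_mn).
have [_] := block_step (s + m%:Z); rewrite ym modn_small //.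
have -> : s + m%:Z + 1 = s + m.+1%:Z by lia.
by move=> -> /=; rewrite tm.
Qed.

Lemma block_next :
  (y (s + n.+1%:Z)).2 = 0 :> nat /\ R (y s).1 (y (s + n.+1%:Z)).1.
Proof.
have [yn tn] := block_interior (leqnn n).
have [_] := block_step (s + n%:Z); rewrite yn modnn tn.
have -> : s + n%:Z + 1 = s + n.+1%:Z by lia.
by move=> -> /=.
Qed.

End Blocks.

Section BlockTails.
Context (V : finType) (R : rel V) (n : nat) (Rtr : transitive R).
Context (y : int -> V * 'I_n.+1) (yE : bipath (block_edge R (n := n)) y).

Lemma block_rank (i : int) : (y i).1 != (y (i + 1)).1 ->
  (rank R (y (i + 1)).1 < rank R (y i).1)%N.
Proof.
have [ri _] := block_step yE i; have [ri1 _ _] := block_step yE (i + 1).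
case: ifP => _ [+ + //]; last by move=> ->; rewrite eqxx.
by move=> Ri neq; apply: rank_lt.
Qed.

Lemma block_tails : exists m : nat, forall i : int,
  (m%:Z <= i -> (y i).1 = (y m%:Z).1) /\
  (i <= - m%:Z -> (y i).1 = (y (- m%:Z)).1).
Proof.
have [|a a_cst] := @eventually_constant _ (rank R) (fun j => (y j%:Z).1).
  by move=> j; have := @block_rank j%:Z; have -> : j%:Z + 1 = j.+1%:Z by lia.
(* Towards -oo the rank grows at each change, so its complement in [#|V|] is the decreasing
   quantity. *)
have [|b b_cst] := @eventually_constant _ (fun v => #|V| - rank R v)%N
    (fun j => (y (- j%:Z)).1).
  move=> j; have := @block_rank (- j.+1%:Z).
  have -> : - j.+1%:Z + 1 = - j%:Z by lia.
  rewrite eq_sym => lt_r /lt_r {}lt_r; apply: ltn_sub2l => //.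
  exact: leq_trans lt_r (max_card _).
rewrite /= in a_cst b_cst; exists (a + b)%N => i; split=> le_i.
  have -> : i = `|i|%N%:Z by lia.
  by rewrite (a_cst `|i|%N) ?(a_cst (a + b)%N) //; lia.
have -> : i = - `|i|%N%:Z by lia.
by rewrite (b_cst `|i|%N) ?(b_cst (a + b)%N) //; lia.
Qed.

End BlockTails.

(** * The sliding block code onto the bi-infinite paths *)

Section Decode.
Context (V : finType) (e : rel V) (n : nat).
Let R := steps e n.+1.
Context (Rtr : transitive R).

Definition pick_letter (c : (V * n.+1.-tuple V) * (V * 'I_n.+1)) : V :=
  if sim R c.2.1 c.1.1 then c.1.1 else c.2.1.

Definition fill (u v : V) (p : n.+1.-tuple V) : n.+1.-tuple V :=
  if walk e u v p then p else odflt p [pick q : n.+1.-tuple V | walk e u v q].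

(* The block containing 0 starts at -k; a letter or path of the full shift that
   does not fit is replaced by a default one. *)
Definition decode (z : int -> (V * n.+1.-tuple V) * (V * 'I_n.+1)) : V :=
  let k := nat_of_ord (z 0).2.2 in
  let u := pick_letter (z (- k%:Z)) in
  let v := pick_letter (z (n.+1%:Z - k%:Z)) in
  nth u (u :: fill u v (z (- k%:Z)).1.2) k.

Lemma sim_pick_letter c : sim R c.2.1 (pick_letter c).
Proof. by rewrite /pick_letter; case: ifP => // _; apply: sim_refl. Qed.

Lemma walk_fill (u v : V) (p : n.+1.-tuple V) :
  R u v -> walk e u v (fill u v p).
Proof.
rewrite /fill; case: ifP => // _ /existsP[q uqv].
by case: pickP => [//|/(_ q)]; rewrite uqv.
Qed.

(** The sites read are [0], [- k] and [n.+1 - k] with [0 <= k <= n]. *)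
Lemma decode_local z z' :
  (forall j : int, - n.+1%:Z <= j <= n.+1%:Z -> z j = z' j) ->
  decode z = decode z'.
Proof.
move=> zz'; rewrite /decode (zz' 0) ?lexx //.
by have ltk := ltn_ord (z' 0).2.2; rewrite !zz' //; lia.
Qed.

(** The endpoints picked for a block lie in classes related by [R], hence are themselves related,
    and the filled word is a genuine walk from one to the other. *)
Lemma decode_bipath z : bipath (block_edge R (n := n)) (fun i => (z i).2) ->
  bipath e (fun i => decode (fun j => z (i + j))).
Proof.
move=> zE i; rewrite /decode !addr0.
have [s0 _] := block_start zE i.
have := ltn_ord (z i).2.2.
have [] := block_step zE i => _ k1 _.
move: (nat_of_ord (z i).2.2) s0 k1 => k.
set s := i - k%:Z => s0 k1 ltk.
have -> : i + (n.+1%:Z - k%:Z) = s + n.+1%:Z by rewrite /s; lia.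
have [next0 Rnext] := block_next zE s0.
set u := pick_letter (z s); set v := pick_letter (z (s + n.+1%:Z)).
have Ruv : R u v.
  by apply: (sim_compat Rtr _ _ Rnext); apply: sim_pick_letter.
have /andP[] := walk_fill (z s).1.2 Ruv.
set p := fill u v _ => /(pathP u) e_p /eqP last_p.
have := e_p k; rewrite size_tuple => /(_ ltk).
rewrite k1.
have [lt_kn|le_nk] := ltnP k n.
  have k1E : (k.+1 %% n.+1)%N = k.+1 by rewrite modn_small.
  rewrite k1E.
  have -> : i + 1 - k.+1%:Z = s by rewrite /s; lia.
  have -> : i + 1 + (n.+1%:Z - k.+1%:Z) = s + n.+1%:Z by rewrite /s; lia.
  by [].
(* At the last position of a block, [i + 1] opens the next block and decodes to [v], which is also
   the final vertex of the walk. *)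
have kn : k = n by apply/eqP; rewrite eqn_leq le_nk andbT -ltnS.
have -> : i + 1 - (k.+1 %% n.+1)%N%:Z = s + n.+1%:Z.
  by rewrite /s kn modnn; lia.
have -> : (k.+1 %% n.+1)%N = 0%N by rewrite kn modnn.
by rewrite /= -/v -last_p -nth_last size_tuple /= {2}kn.
Qed.

(** The preimage proposes at each site the vertex of the path and the [n.+1] vertices after it;
    these proposals fit the classes, so decoding keeps them. *)
Lemma decode_surjective (v : int -> V) : bipath e v ->
  exists2 z, bipath (block_edge R (n := n)) (fun i => (z i).2)
    & forall i, decode (fun j => z (i + j)) = v i.
Proof.
move=> vE.
have walk_v i m :
    walk e (v i) (v (i + m%:Z)) [seq v (i + j.+1%:Z) | j <- iota 0 m].
  elim: m => [|m IHm]; first by rewrite /walk /= addr0 eqxx.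
  rewrite -[in iota _ _]addn1 iotaD map_cat /walk cat_path last_cat /=.
  have /andP[-> /eqP ->] := IHm.
  by have := vE (i + m%:Z); rewrite -addrA -PoszD addn1 => ->; rewrite eqxx.
(* Blocks are cut at the multiples of [n.+1]; the integer remainder is nonnegative for negative [i]
   too. *)
pose phase (i : int) : nat := `|(i %% n.+1%:Z)%Z|%N.
have phaseE i : (phase i)%:Z = (i %% n.+1%:Z)%Z.
  by rewrite /phase gez0_abs // modz_ge0.
have phase_lt i : (phase i < n.+1)%N.
  by rewrite -ltz_nat phaseE ltz_pmod.
have phaseS i : phase (i + 1) = ((phase i).+1 %% n.+1)%N.
  apply/eqP; rewrite -eqz_nat; apply/eqP.
  by rewrite phaseE -modzDml -(phaseE i) addrC -intS modz_nat.
pose start i := i - (phase i)%:Z.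
have phase_start i : phase (start i) = 0%N.
  apply/eqP; rewrite -eqz_nat; apply/eqP.
  by rewrite phaseE /start phaseE {1}(divz_eq i n.+1%:Z) addrK modzMl.
have phase_next i : phase (start i + n.+1%:Z) = 0%N.
  apply/eqP; rewrite -eqz_nat; apply/eqP.
  by rewrite phaseE modzDr -phaseE phase_start.
have startS i : start (i + 1) =
    if phase (i + 1) == 0%N then start i + n.+1%:Z else start i.
  have := phase_lt i; rewrite ltnS leq_eqVlt => /predU1P[pn|lt_pn].
    by rewrite /start phaseS pn modnn /=; lia.
  by rewrite /start phaseS modn_small //=; lia.
pose word i := [tuple of mkseq (fun j => v (i + j.+1%:Z)) n.+1].
exists (fun i => ((v i, word i), (rep R (v (start i)), Ordinal (phase_lt i)))).
  move=> i; apply/and3P; split => /=.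
  - by rewrite rep_rep.
  - by apply/eqP/val_inj; rewrite /= phaseS.
  rewrite startS; case: eqP => // _.
  apply: (sim_compat Rtr (sim_rep _ _) (sim_rep _ _)).
  apply/stepsP; exists [seq v (start i + j.+1%:Z) | j <- iota 0 n.+1] => //.
  by rewrite size_map size_iota.
move=> i; rewrite /decode !addr0 /=.
have pick_v j : phase j = 0%N ->
    pick_letter ((v j, word j), (rep R (v (start j)), Ordinal (phase_lt j))) =
    v j.
  by move=> p0; rewrite /pick_letter /= /start p0 subr0 sim_sym sim_rep.
have -> : i + (n.+1%:Z - (phase i)%:Z) = start i + n.+1%:Z.
  by rewrite /start; lia.
rewrite -/(start i) !pick_v // /fill walk_v.
rewrite -[in RHS](subrK (phase i)%:Z i) -/(start i).
case: (phase i) (phase_lt i) => [|k] lt_k /=; first by rewrite addr0.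
by rewrite nth_mkseq // ltnW.
Qed.

End Decode.

(** * One-dimensional subshifts *)

Definition row1 (i : int) : 'rV[int]_1 := const_mx i.

Lemma row1K (p : 'rV[int]_1) : row1 (p 0 0) = p.
Proof. by apply/rowP => j; rewrite mxE ord1. Qed.

Lemma row1E (i : int) : row1 i 0 0 = i. Proof. by rewrite mxE. Qed.

Lemma row1D (i j : int) : row1 (i + j) = row1 i + row1 j.
Proof. by apply/rowP => k; rewrite !mxE. Qed.

Definition path_shift (C : finType) (E : rel C) : set (config 1 C) :=
  [set x | bipath E (fun i => x (row1 i))].

Lemma sigma_shiftK (d : nat) (A : finType) (p : 'rV[int]_d) (x : config d A) :
  sigma_shift p (sigma_shift (- p) x) = x.
Proof. by apply/funext => q; rewrite /sigma_shift addKr. Qed.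

Lemma shift_invariant (d : nat) (A : finType) (X : set (config d A)) :
  (forall p x, X x -> X (sigma_shift p x)) -> forall p, sigma_shift p @` X = X.
Proof.
move=> invX p; apply/seteqP; split=> [_ [x Xx <-]|x Xx]; first exact: invX.
by exists (sigma_shift (- p) x); [apply: invX | rewrite sigma_shiftK].
Qed.

Lemma path_shift_is_subshift (C : finType) (E : rel C) :
  is_subshift (path_shift E).
Proof.
split.
  apply: closed_local => x loc i.
  have [y Ey yx] := loc [:: row1 i; row1 (i + 1)].
  by rewrite -!yx ?inE ?eqxx ?orbT //; apply: Ey.
apply: shift_invariant => p x Ex i.
by rewrite /sigma_shift -[p]row1K -!row1D addrA; apply: Ex.
Qed.

(** By [block_tails] the shift is covered by the sets [Ym m], whose classes are constant beyond [m]
    on both sides; restriction to the window from [- m] to [m] embeds each of them in a finite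
    type. *)
Lemma block_shift_countable (V : finType) (R : rel V) (n : nat) :
  transitive R -> countable (path_shift (block_edge R (n := n))).
Proof.
move=> Rtr; set Y := path_shift _.
pose Ym (m : nat) := [set y : config 1 (V * 'I_n.+1)%type | Y y /\
  forall i : int, (m%:Z <= i -> (y (row1 i)).1 = (y (row1 m%:Z)).1) /\
    (i <= - m%:Z -> (y (row1 i)).1 = (y (row1 (- m%:Z))).1)].
apply: (@sub_countable _ _ _ (\bigcup_m Ym m)).
  apply: subset_card_le => y Yy.
  by have [m ym] := block_tails Rtr Yy; exists m.
apply: bigcup_countable => // m _.
pose f (y : config 1 (V * 'I_n.+1)%type) :=
  [ffun j : 'I_(m + m).+1 => y (row1 (j%:Z - m%:Z)) : V * 'I_n.+1].
suff f_inj : {in Ym m &, injective f}.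
  by rewrite -(eq_countable (inj_card_eq f_inj)); apply: countableP.
move=> y y' /set_mem[Yy ty] /set_mem[Yy' ty'] /ffunP eqf.
have eqm (i : int) : - m%:Z <= i <= m%:Z -> y (row1 i) = y' (row1 i).
  move=> im; have ltj : (`|(i + m%:Z)%R| < (m + m).+1)%N by lia.
  have := eqf (Ordinal ltj); rewrite !ffunE /=.
  by have -> : `|(i + m%:Z)%R|%N%:Z - m%:Z = i by lia.
have eqt (i : int) : (y (row1 i)).1 = (y' (row1 i)).1.
  have [le_i|lt_i] := lerP i (- m%:Z).
    by rewrite (ty i).2 // (ty' i).2 // eqm //; lia.
  have [le_m|lt_m] := lerP m%:Z i; last by rewrite eqm //; lia.
  by rewrite (ty i).1 // (ty' i).1 // eqm //; lia.
have phaseS z (Yz : Y z) (i : int) : (z (row1 (i + 1))).2 = ordS (z (row1 i)).2.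
  by have /and3P[_ /eqP] := Yz i.
(* The phases advance by [ordS], which is injective, so the phase at [0] determines all the others
   in both directions. *)
have eqp (i : int) : (y (row1 i)).2 = (y' (row1 i)).2.
  elim: i => [|i IHi|i IHi]; first by rewrite eqm //; lia.
    by rewrite intS addrC !phaseS // IHi.
  have := phaseS y Yy (- i.+1%:Z); have := phaseS y' Yy' (- i.+1%:Z).
  have -> : - i.+1%:Z + 1 = - i%:Z by lia.
  by rewrite IHi => -> /(can_inj (@ordSK _)).
apply/funext => p; rewrite -[p]row1K.
by apply/eqP; rewrite -pair_eqE /= /pair_eq eqt eqp !eqxx.
Qed.

(** The factor map is [decode] followed by the labelling [h]. Its domain is a product indexed by
    [bool]: [true] for the full shift of free choices, [false] for the countable block shift. *)
Lemma sofic_L0 (V A : finType) (e : rel V) (h : V -> A)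
    (X : set (config 1 A)) :
  is_subshift X ->
  X = [set x : config 1 A |
        exists2 v, bipath e v & forall p, x p = h (v (p 0 0))] ->
  L0_dim X.
Proof.
move=> subX XE; have [n Rtr] := steps_transitive e; set R := steps _ _ in Rtr.
pose Alph (b : bool) : finType :=
  if b then ((V * n.+1.-tuple V)%type : finType)
  else ((V * 'I_n.+1)%type : finType).
pose comp (b : bool) : set (config 1 (Alph b)) :=
  match b return set (config 1 (Alph b)) with
  | true => @full_shift 1 _
  | false => path_shift (block_edge R (n := n))
  end.
pose dom := product_shift comp.
pose coords (x : config 1 {dffun forall b, Alph b}) (i : int) :
  (V * n.+1.-tuple V) * (V * 'I_n.+1) :=
  ((x (row1 i) : {dffun forall b, Alph b}) true,
   (x (row1 i) : {dffun forall b, Alph b}) false).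
pose code (x : config 1 {dffun forall b, Alph b}) : config 1 A :=
  fun p => h (decode e (fun j => coords x (p 0 0 + j))).
have codeX (x : dom) : code (val x) \in X.
  apply/mem_set; rewrite XE /=.
  exists (fun i => decode e (fun j => coords (val x) (i + j))) => //.
  apply: decode_bipath => // i.
  exact: (set_mem (valP x) false i).
apply: (L0_factor (X := dom)) => //.
  apply: L0_product => -[] /=; apply: L0_basic; first exact: basic_full.
  apply: basic_countable; first exact: path_shift_is_subshift.
  exact: block_shift_countable.
exists (fun x : dom => exist _ (code (val x)) (codeX x) : X); split.
(* The window holds the offsets from [- n.+1] to [n.+1], which are [n.+1 + n.+2] in number. *)
- apply: (@sliding_block_continuous _ _ _ _ _ _
    [seq row1 (k%:Z - n.+1%:Z) | k <- iota 0 (n.+1 + n.+2)]).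
  move=> x x' p eqx /=; congr h; apply: decode_local => j jn.
  have eqj : (val x : config 1 _) (row1 (p 0 0 + j)) =
             (val x' : config 1 _) (row1 (p 0 0 + j)).
    rewrite row1D row1K; apply: eqx; apply/mapP.
    exists `|(j + n.+1%:Z)%R|%N; first by rewrite mem_iota; lia.
    by congr row1; lia.
  by rewrite /coords eqj.
- apply/seteqP; split=> // y _.
  have := set_mem (valP y); rewrite {1}XE => -[v /decode_surjective].
  move=> /(_ n Rtr)[z zE zv] yv.
  pose x : config 1 {dffun forall b, Alph b} := fun p =>
    [ffun b => match b return Alph b with
               | true => (z (p 0 0)).1 | false => (z (p 0 0)).2 end].
  have coordsx i : coords x i = z i.
    by rewrite /coords /x !ffunE row1E -surjective_pairing.
  have domx : x \in dom.
    apply/mem_set => -[] //= i.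
    by have := zE i; rewrite -!coordsx.
  exists (exist _ x domx) => //; apply/val_inj => /=.
  apply/funext => p; rewrite yv -zv /code; congr (h (decode e _)).
  by apply/funext => j; rewrite coordsx.
- move=> p x x' /= xx'; apply/funext => q; rewrite /sigma_shift /code.
  congr (h (decode e _)); apply/funext => j.
  by rewrite /coords xx' /sigma_shift !row1D !row1K addrA.
Qed.

(** * Subshifts of finite type as labelled paths of a finite graph *)

Lemma patterns_bounded (A : finType) (P : {fset pattern 1 A}) :
  exists M : nat, forall w, w \in P -> forall q : domf w,
    (`|(val q : 'rV[int]_1) 0%R 0%R| <= M)%N.
Proof.
exists (\max_(w <- enum_fset P) \max_(q : domf w)
  `|(val q : 'rV[int]_1) 0%R 0%R|%N) => w wP q.
apply: leq_trans (leq_bigmax_seq _ wP isT).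
exact: (leq_bigmax q).
Qed.

(** This is the higher block presentation: vertices are words of length [2M + 1], wide enough for
    every forbidden pattern, edges are overlaps by one shift, and the label is the first letter. *)
Lemma finite_type_sofic (A : finType) (X : set (config 1 A)) :
  finite_type X ->
  exists (V : finType) (e : rel V) (h : V -> A),
  X = [set x : config 1 A |
        exists2 v, bipath e v & forall p, x p = h (v (p 0 0))].
Proof.
move=> [P ->]; have [M bndM] := patterns_bounded P.
pose V : finType := {ffun 'I_(M + M).+1 -> A}.
(* Words are read as centred: coordinate [c] of a pattern sits at index [c + M], and the bound [M]
   keeps [inord] away from its default value. *)
pose allowed (u : V) := forall w, w \in P -> ~ forall q : domf w,
  u (inord `|((val q : 'rV[int]_1) 0 0 + M%:Z)%R|%N) = w q.
pose e : rel V := fun u v => `[< allowed u >] &&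
  [forall k : 'I_(M + M).+1, (k.+1 < (M + M).+1)%N ==> (u (inord k.+1) == v k)].
exists V, e, (fun u : V => u ord0).
have inordE (w : pattern 1 A) (q : domf w) : w \in P ->
    (inord `|((val q : 'rV[int]_1) 0 0 + M%:Z)%R|%N : 'I_(M + M).+1) =
      ((val q : 'rV[int]_1) 0 0 + M%:Z)%R :> int.
  move=> /bndM/(_ q); move: ((val q : 'rV[int]_1) 0 0) => c le_c.
  by rewrite inordK; lia.
apply/seteqP; split=> x /=.
  move=> Xx; exists (fun i => [ffun k : 'I_(M + M).+1 => x (row1 (i + k%:Z))]).
    move=> i; apply/andP; split.
      apply/asboolP => w wP occ; apply: (Xx w wP (row1 (i + M%:Z))) => q.
      have := occ q; rewrite ffunE inordE // => <-; congr x.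
      by rewrite -[val q in LHS]row1K -row1D; congr row1; lia.
    apply/forallP => k; apply/implyP => ltk; rewrite !ffunE inordK //.
    by apply/eqP; congr (x (row1 _)); lia.
  by move=> p; rewrite ffunE addr0 row1K.
move=> [v ve xv] w wP p occ.
(* Through the overlaps, letter [k] of the word at [i] is the first letter of the word at
   [i + k]. *)
have vE (k : nat) : (k < (M + M).+1)%N ->
    forall i, v i (inord k) = v (i + k%:Z) ord0.
  elim: k => [|k IHk] ltk i.
    by rewrite addr0; congr (v i _); apply/val_inj; rewrite /= inordK.
  have /andP[_ /forallP/(_ (inord k))] := ve i.
  rewrite inordK ?(ltnW ltk) // ltk /= => /eqP ->.
  by rewrite IHk ?(ltnW ltk) //; congr (v _ _); lia.
(* The word starting at [p - M] is centred at [p], so it contains the supposed occurrence. *)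
have /andP[/asboolP ok _] := ve (p 0 0 - M%:Z).
apply: (ok w wP) => q; rewrite -occ xv vE; last first.
  by have := bndM w wP q; move: ((val q : 'rV[int]_1) 0 0) => c; lia.
congr (v _ _); rewrite mxE; have := bndM w wP q.
by move: ((val q : 'rV[int]_1) 0 0) (p 0 0) => c b; lia.
Qed.

Theorem theorem7p2 (A : finType) (X : set (config 1 A)) :
  is_subshift X -> finite_type X -> L0 X.
Proof.
move=> subX /finite_type_sofic[V [e [h XE]]]; split=> //.
exact: sofic_L0 subX XE.
Qed.
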